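(* Assume Conditions (C1) and (C2) below, let $c>0$ and $0<\tau<1/2$ be constants, and let $k=\max\{k_1,\dots,k_s\}$. Then there exists a constant $\eta>0$, depending only on $c,\tau$-free quantities $\kappa_0,K,a,b,g$ and $c$ (not on $N,m,n,p$), such that for all $N,m$ with $n=N/m$ a positive integer and $k\le n$, $$ P\Big(\max_{1\le j\le p}|\widetilde\omega_j-\omega_j|\ge cN^{-\tau}\Big)\le \eta\,p\,\big(1-N^{-2\tau}/\eta\big)^{m\lfloor n/k\rfloor}. $$
   Context: Let $(Y_i,\mathbf X_i)$, $i=1,\dots,N$, be i.i.d. copies of $(Y,\mathbf X)$, with $Y$ a real response and $\mathbf X=(X_1,\dots,X_p)^T$; write $X_{ij}$ for the $j$-th entry of $\mathbf X_i$ and $Z_{ij}=(Y_i,X_{ij})$. The index set $\{1,\dots,N\}$ is partitioned into $m$ disjoint sets $\mathcal S_1,\dots,\mathcal S_m$, each of size $n=N/m$. For each $j$ and $h=1,\dots,s$, $\theta_{j,h}$ is a real component parameter and $\hat\theta_{j,h}(z_1,\dots,z_{k_h})$ is a symmetric measurable kernel of degree $k_h$ (same $k_h$ for all $j$) with $E\,\hat\theta_{j,h}(Z_{i_1j},\dots,Z_{i_{k_h}j})=\theta_{j,h}$ for distinct indices. The local U-statistic is $U^l_{j,h}=\binom{n}{k_h}^{-1}\sum_{\{i_1,\dots,i_{k_h}\}\subseteq\mathcal S_l}\hat\theta_{j,h}(Z_{i_1j},\dots,Z_{i_{k_h}j})$ (sum over all $k_h$-subsets of $\mathcal S_l$), and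 $\bar U_{j,h}=\frac1m\sum_{l=1}^mU^l_{j,h}$. The correlation measure between $Y$ and $X_j$ is $\omega_j=g(\theta_{j,1},\dots,\theta_{j,s})$ for a fixed function $g$ (the same for all $j$), and the aggregated estimator is $\widetilde\omega_j=g(\bar U_{j,1},\dots,\bar U_{j,s})$. Condition (C1): there exist constants $\kappa_0>0$ and $K<\infty$ with $E\exp\{\kappa_0|\hat\theta_{j,h}(Z_{1j},\dots,Z_{k_hj})|\}\le K$ for all $j,h$. Condition (C2): $g$ is given by a fixed finite expression built from its arguments using addition, subtraction, multiplication, division, absolute value and square root; moreover there are constants $a,b>0$ such that, for every $j$, $|\theta_{j,h}|\le a$ for all $h$, every subexpression of $g$ used as a denominator has absolute value at least $b$ when evaluated at $(\theta_{j,1},\dots,\theta_{j,s})$, and every subexpression under a square root has value at least $b$ there. (Events where $\widetilde\omega_j$ is undefined are counted in the deviation event.) *)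

(* Defs.v *)
From HB Require Import structures.
From mathcomp Require Import all_boot all_order all_algebra.
From mathcomp Require Import all_classical all_reals all_analysis.
Set Implicit Arguments. Unset Strict Implicit. Unset Printing Implicit Defensive.
Import Order.TTheory GRing.Theory Num.Theory.
Local Open Scope ring_scope.

Inductive gexpr (R : Type) (s : nat) : Type :=
| EVar of 'I_s
| EConst of R
| EAdd of gexpr R s & gexpr R s
| ESub of gexpr R s & gexpr R s
| EMul of gexpr R s & gexpr R s
| EDiv of gexpr R s & gexpr R s
| EAbs of gexpr R s
| ESqrt of gexpr R s.

Section Expr.
Variables (R : realType) (s : nat).

Fixpoint geval (e : gexpr R s) (v : 'I_s -> R) : option R :=
  match e with
  | EVar i => Some (v i)
  | EConst r => Some r
  | EAdd e1 e2 => match geval e1 v, geval e2 v with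
                  | Some x, Some y => Some (x + y) | _, _ => None end
  | ESub e1 e2 => match geval e1 v, geval e2 v with
                  | Some x, Some y => Some (x - y) | _, _ => None end
  | EMul e1 e2 => match geval e1 v, geval e2 v with
                  | Some x, Some y => Some (x * y) | _, _ => None end
  | EDiv e1 e2 => match geval e1 v, geval e2 v with
                  | Some x, Some y => if y == 0 then None else Some (x / y)
                  | _, _ => None end
  | EAbs e1 => match geval e1 v with Some x => Some `|x| | None => None end
  | ESqrt e1 => match geval e1 v with
                | Some x => if x < 0 then None else Some (Num.sqrt x)
                | None => None end
  end.

Fixpoint gnondeg (b : R) (e : gexpr R s) (v : 'I_s -> R) : Prop :=
  match e with
  | EVar _ | EConst _ => True
  | EAdd e1 e2 | ESub e1 e2 | EMul e1 e2 =>
      gnondeg b e1 v /\ gnondeg b e2 v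
  | EDiv e1 e2 => [/\ gnondeg b e1 v, gnondeg b e2 v &
                     exists y, geval e2 v = Some y /\ b <= `|y|]
  | EAbs e1 => gnondeg b e1 v
  | ESqrt e1 => gnondeg b e1 v /\ exists y, geval e1 v = Some y /\ b <= y
  end.
End Expr.

(* Turning a sequence into a k-tuple (used only on sequences of size k). *)
Definition to_tuple (A : Type) (k : nat) (x0 : A) (l : seq A) : k.-tuple A :=
  insubd [tuple of nseq k x0] l.

Section UStat.
Variables (R : realType) (T : Type) (N p : nat).
(* Z i w = (Y_i(w), X_i(w)) with X_i(w) a p-tuple *)
Variable Z : 'I_N -> T -> R * p.-tuple R.

Definition Zpair (i : 'I_N) (j : 'I_p) (w : T) : R * R :=
  ((Z i w).1, tnth (Z i w).2 j).

Definition kern_at (k : nat) (ker : k.-tuple (R * R) -> R) (j : 'I_p)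
  (t : seq 'I_N) (w : T) : R :=
  ker (to_tuple k (0, 0) [seq Zpair i j w | i <- t]).

Definition local_U (n k : nat) (ker : k.-tuple (R * R) -> R) (j : 'I_p)
  (S : {set 'I_N}) (w : T) : R :=
  ('C(n, k)%:R)^-1 *
  \sum_(A : {set 'I_N} | (A \subset S) && (#|A| == k)) kern_at ker j (enum A) w.

Definition agg_U (m n k : nat) (ker : k.-tuple (R * R) -> R) (j : 'I_p)
  (Sb : 'I_m -> {set 'I_N}) (w : T) : R :=
  (m%:R)^-1 * \sum_(l < m) local_U n ker j (Sb l) w.
End UStat.

(* Main.v *)
(** Near a point satisfying (C2) the expression g is Lipschitz, so a deviation of
    g of order N^-tau forces one of the aggregated U-statistics to deviate by a
    multiple of N^-tau.  For a single U-statistic we use Chernoff's method.  By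
    Hoeffding's representation each local U-statistic is an average, over the
    permutations of its block, of means of r = n %/ k kernels evaluated on
    pairwise disjoint index sets; convexity of exp and independence bound its
    Laplace transform by the r-th power of that of one centred kernel, which by
    (C1) is at most 1 + O(lam^2).  Taking lam of order N^-tau, the m independent
    blocks give (1 - N^(-2 tau) / eta)^(m r), and a union bound concludes. *)
Require Import Defs.
From HB Require Import structures.
From mathcomp Require Import all_boot all_order all_algebra.
From mathcomp Require Import fingroup perm ring lra.
From mathcomp Require Import all_classical all_reals all_analysis.
From mathcomp Require Import measurable_realfun.
Set Implicit Arguments.
Unset Strict Implicit.
Unset Printing Implicit Defensive.
Import Order.TTheory GRing.Theory Num.Theory.
Local Open Scope classical_set_scope.
Local Open Scope ring_scope.

(** * Elementary inequalities for the exponential *)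

Section RealInequalities.
Variable R : realType.
Implicit Types x y : R.

Lemma expR_sub1_le x : expR x - 1 <= x * expR x.
Proof.
have h := expR_ge1Dx (- x).
have : (1 - x) * expR x <= expR (- x) * expR x by rewrite ler_pM2r ?expR_gt0.
by rewrite -expRD addNr expR0; lra.
Qed.

(** Since [e^x - 1 <= x e^x], the remainder [e^x - 1 - x] is at most [x (e^x - 1)]. For [x >= 0]
    this is at most [x^2 e^x] by the same inequality; for [x < 0] it is at most [x^2] because
    [e^x >= 1 + x]. *)
Lemma expR_le_quadratic x : expR x <= 1 + x + x ^+ 2 * expR `|x|.
Proof.
have h := expR_sub1_le x; have e0 := expR_gt0 x; have e1 := expR_ge1Dx x.
case: (leP 0 x) => x0.
  rewrite ger0_norm //.
  have : 0 <= x * (x * expR x - (expR x - 1)) by apply: mulr_ge0 => //; lra.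
  by nra.
have : expR 0 <= expR `|x| by rewrite ler_expR.
rewrite expR0 => en.
have : 0 <= x ^+ 2 * (expR `|x| - 1) by apply: mulr_ge0; [rewrite sqr_ge0|lra].
have : 0 <= (- x) * (expR x - 1 - x) by apply: mulr_ge0 => //; lra.
by nra.
Qed.

Lemma sqr_le_expR x : 0 <= x -> x ^+ 2 <= 2 * expR x.
Proof.
move=> x0; have := @expR_ge1Dxn R x 1 x0.
by rewrite (_ : 2`!%:R = 2 :> R) //; lra.
Qed.

(** On [[0, 1]] one has [e^(-x) <= 1 / (1 + x) <= 1 - x / 2]. This turns an exponential Chernoff
    rate into the form [1 - N^(-2 tau) / eta]. *)
Lemma expRN_le_lin x : 0 <= x -> x <= 1 -> expR (- x) <= 1 - x / 2.
Proof.
move=> x0 x1; have h := expR_ge1Dx x.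
have : expR (- x) * (1 + x) <= expR (- x) * expR x by rewrite ler_pM2l ?expR_gt0.
rewrite -expRD addNr expR0 => h1.
have : 0 <= (1 - x / 2) * (1 + x) - 1 by nra.
move=> h2; rewrite -(@ler_pM2r _ (1 + x)); lra.
Qed.

(** Each [expR (f i)] lies above the tangent of [expR] at the mean [mu]; on averaging, the linear
    terms cancel. *)
Lemma jensen_expR (I : finType) (P : pred I) (f : I -> R) : (0 < #|P|)%N ->
  expR (#|P|%:R^-1 * \sum_(i | P i) f i) <=
  #|P|%:R^-1 * \sum_(i | P i) expR (f i).
Proof.
move=> P0; set c := _^-1; set mu := c * _.
have c0 : 0 < c by rewrite invr_gt0 ltr0n.
have cP : c * #|P|%:R = 1 by rewrite mulVf // pnatr_eq0 -lt0n.
have h i : expR mu * (1 + (f i - mu)) <= expR (f i).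
  have := expR_ge1Dx (f i - mu).
  rewrite -(@ler_pM2l _ (expR mu)) ?expR_gt0 // -expRD.
  by rewrite (addrC mu) subrK.
have := @ler_sum _ I (index_enum I) P _ _ (fun i _ => h i).
rewrite -(@ler_pM2l _ c) //; apply: le_trans.
rewrite -big_distrr /= big_split /= sumrB !sumr_const mulrCA mulrDr mulrBr cP.
by rewrite -[mu *+ _]mulr_natr [c * (mu * _)]mulrCA cP mulr1 subrr addr0 mulr1.
Qed.

End RealInequalities.

(** * Permutations and subsets of a finite set *)

Section Combinatorics.
Variable T : finType.
Implicit Types (S A B : {set T}).

(** Induction on the size of [B :\: B']: a transposition exchanging some [x] in [B :\: B'] with some
    [y] in [B' :\: B], which exists by equality of cardinals, brings [B] one element closer to
    [B']. *)
Lemma perm_on_imset_ex S B B' : B \subset S -> B' \subset S -> #|B| = #|B'| ->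
  exists2 u : {perm T}, perm_on S u & u @: B = B'.
Proof.
have [n] := ubnP #|B :\: B'|; elim: n B => // n IH B.
rewrite ltnS => ltBn sBS sB'S eqB.
case: (finset.set_0Vmem (B :\: B')) => [/eqP|[x]].
  rewrite finset.setD_eq0 => sBB'; exists (1 : {perm T})%g; first by apply: perm_on1.
  have -> : B = B' by apply/eqP; rewrite eqEcard sBB' eqB leqnn.
  by rewrite -[RHS]imset_id; apply: eq_imset => z; rewrite perm1.
rewrite inE => /andP[xB' xB].
have : (0 < #|B' :\: B|)%N.
  rewrite cardsD finset.setIC -eqB -cardsD card_gt0; apply/finset.set0Pn; exists x.
  by rewrite inE xB' xB.
rewrite card_gt0 => /finset.set0Pn[y]; rewrite inE => /andP[yB yB'].
have xy : x != y by apply: contraNneq xB' => ->.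
have pt : perm_on S (tperm x y).
  apply/fintype.subsetP => z; rewrite inE; case: tpermP => [-> _|-> _|_ _].
  - exact: (fintype.subsetP sBS).
  - exact: (fintype.subsetP sB'S).
  - by rewrite eqxx.
pose B1 := tperm x y @: B.
have sB1 : B1 \subset S.
  by rewrite -(im_perm_on pt); apply: imsetS.
have B1D : (#|B1 :\: B'| < n)%N.
  apply: leq_trans ltBn; apply: proper_card; apply/properP; split.
    apply/fintype.subsetP => z; rewrite !inE => /andP[zB' /imsetP[w wB zw]].
    move: zw zB'; case: tpermP => [_ ->|wy|_ _ -> ->].
    - by rewrite yB'.
    - by rewrite -wy wB in yB.
    - by rewrite wB.
  exists x; first by rewrite inE xB' xB.
  rewrite inE xB' /=; apply/imsetP => -[w wB].
  case: tpermP => [wx xyE|wy _|wx _ xw].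
  - by rewrite xyE eqxx in xy.
  - by rewrite -wy wB in yB.
  - by case: wx; rewrite -xw.
have cB1 : #|B1| = #|B'| by rewrite card_imset //; apply: perm_inj.
have [u pu uB1] := IH B1 B1D sB1 sB'S cB1.
exists (tperm x y * u)%g; first exact: perm_onM.
by rewrite -uB1 -imset_comp; apply: eq_imset => z; rewrite permM.
Qed.

(* Averaging over the permutations of S makes the image of any fixed k-subset
   uniformly distributed among the k-subsets of S. *)
Lemma sum_perm_on_imset (V : nmodType) S (F : {set T} -> V) k B :
  B \subset S -> #|B| = k ->
  (\sum_(u : {perm T} | perm_on S u) F (u @: B)) *+ 'C(#|S|, k) =
  (\sum_(A : {set T} | (A \subset S) && (#|A| == k)) F A)
    *+ #|[pred u : {perm T} | perm_on S u]|.
Proof.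
move=> sBS cB.
have cardS : #|[pred A : {set T} | (A \subset S) && (#|A| == k)]| = 'C(#|S|, k).
  by rewrite -cards_draws cardsE; apply: eq_card => A; rewrite !inE.
rewrite -cardS -[LHS]sumr_const -[RHS]sumr_const /=.
(* Double counting: if [v] sends [B] to [A], the substitution [u := v * u] replaces [B] by [A] in
   the sum over permutations. After exchanging the sums, each fixed [u] merely permutes the
   [k]-subsets of [S]. *)
transitivity (\sum_(A : {set T} | (A \subset S) && (#|A| == k))
    \sum_(u : {perm T} | perm_on S u) F (u @: A)).
  apply: eq_bigr => A /andP[sAS /eqP cA].
  have [v pv vB] : exists2 v : {perm T}, perm_on S v & v @: B = A.
    by apply: perm_on_imset_ex => //; rewrite cA cB.
  rewrite (reindex_inj (mulgI v)) /=; apply: eq_big => [u|u _].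
    apply/idP/idP => [pu|]; last exact: perm_onM.
    have -> : u = (v^-1 * (v * u))%g by rewrite mulKg.
    by apply: perm_onM => //; apply: perm_onV.
  rewrite -vB -imset_comp; congr F; apply: eq_imset => z; by rewrite permM.
rewrite exchange_big /=; apply: eq_bigr => u pu.
have bij : {on [pred A : {set T} | (A \subset S) && (#|A| == k)],
    bijective (fun A : {set T} => u @: A)}.
  exists (fun A : {set T} => (u^-1)%g @: A) => A _; rewrite -imset_comp -[RHS]imset_id;
  by apply: eq_imset => z /=; rewrite ?permK ?permKV.
rewrite [RHS](reindex _ bij) /=; apply: eq_bigl => A.
rewrite card_imset; last exact: perm_inj.
congr (_ && _); rewrite -{2}(im_perm_on pu).
apply/idP/idP => [|/fintype.subsetP h]; first exact: imsetS.
apply/fintype.subsetP => z zA; have := h _ (imset_f u zA).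
by rewrite mem_imset //; apply: perm_inj.
Qed.

(** Greedy choice: cut [k] elements off [S] and recurse on the rest. Indexing the blocks by [nat]
    makes the shift in the recursion a plain successor. *)
Lemma disjoint_blocks_ex k r S : (r * k <= #|S|)%N ->
  exists B : nat -> {set T},
    (forall q, (q < r)%N -> B q \subset S /\ #|B q| = k) /\
    (forall q q', (q < r)%N -> (q' < r)%N -> q != q' -> [disjoint B q & B q']%B).
Proof.
elim: r S => [|r IH] S; first by exists (fun=> finset.set0); split.
rewrite mulSn => le_rk.
have [A [sAS cA]] : exists A : {set T}, A \subset S /\ #|A| = k.
  have /card_geqP [s [us ss sS]] : (k <= #|S|)%N by apply: leq_trans le_rk; rewrite leq_addr.
  exists [set:: s]; split; first by apply/fintype.subsetP => x; rewrite inE; apply: sS.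
  by rewrite cardsE; move/card_uniqP: us => ->.
have [|B [B1 B2]] := IH (S :\: A).
  by rewrite cardsD (finset.setIidPr sAS) cA leq_subRL // (leq_trans _ le_rk) // leq_addr.
have B3 q : (q < r)%N -> [disjoint A & B q]%B.
  move=> /B1[/finset.subsetDP[_ h] _]; by rewrite disjoint_sym.
exists (fun q => if q is q'.+1 then B q' else A); split.
  case=> [|q]; first by [].
  by rewrite ltnS => /B1[/finset.subsetDP[]].
case=> [|q] [|q'] //.
- by move=> _ ? _; apply: B3.
- by move=> ? _ _; rewrite disjoint_sym; apply: B3.
- exact: B2.
Qed.

End Combinatorics.

(** * Local Lipschitz stability of expressions *)

Section ExpressionStability.
Variables (R : realType) (s : nat).

(** Split [uv - xy = (u - x) v + x (v - y)]. The cap [e] on [d] bounds [v] by [N + K e], so that the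
    Lipschitz constant does not involve [d]. *)
Lemma mulr_dist_le (x y u v M N L K d e : R) :
  `|x| <= M -> `|y| <= N -> `|u - x| <= L * d -> `|v - y| <= K * d ->
  0 <= K -> 0 <= L -> 0 <= d -> d <= e ->
  `|u * v - x * y| <= (L * (N + K * e) + M * K) * d.
Proof.
move=> xM yN uL vK K0 L0 d0 de.
have vN : `|v| <= N + K * e.
  have -> : v = y + (v - y) by rewrite addrC subrK.
  apply: le_trans (ler_normD _ _) _; apply: lerD => //.
  by apply: le_trans vK _; rewrite ler_wpM2l.
have -> : u * v - x * y = (u - x) * v + x * (v - y) by ring.
apply: le_trans (ler_normD _ _) _; rewrite !normrM mulrDl; apply: lerD.
  by rewrite mulrAC; apply: ler_pM.
by rewrite -mulrA; apply: ler_pM.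
Qed.

(** The smallness of [L * d] keeps [|v|] above [b / 2], hence [|v y|] above [b^2 / 2]. *)
Lemma invr_dist_le (y v b L d : R) : 0 < b -> b <= `|y| ->
  `|v - y| <= L * d -> L * d <= b / 2 ->
  v != 0 /\ `|v^-1 - y^-1| <= (L * 2 / b ^+ 2) * d.
Proof.
move=> b0 by_ vL Lb.
have vb : b / 2 <= `|v|.
  have := ler_normD v (y - v); rewrite (addrC v) subrK distrC => h.
  by lra.
have v0 : v != 0 by rewrite -normr_gt0; lra.
have y0 : y != 0 by rewrite -normr_gt0; lra.
split=> //.
have -> : v^-1 - y^-1 = - ((v - y) / (v * y)) by field; rewrite v0 y0.
rewrite normrN normrM normfV normrM.
have -> : L * 2 / b ^+ 2 * d = (L * d) * (b / 2 * b)^-1.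
  by field; rewrite gt_eqF.
apply: ler_pM => //; rewrite lef_pV2 ?posrE ?mulr_gt0 ?normr_gt0 ?divr_gt0 //.
by apply: ler_pM => //; lra.
Qed.

(** Multiply by the conjugate: [Num.sqrt v + Num.sqrt y] is at least [Num.sqrt b]. *)
Lemma sqrtr_dist_le (y v b L d : R) : 0 < b -> b <= y ->
  `|v - y| <= L * d -> L * d <= b / 2 ->
  0 <= v /\ `|Num.sqrt v - Num.sqrt y| <= (L / Num.sqrt b) * d.
Proof.
move=> b0 by_ vL Lb.
have v0 : 0 <= v by move: vL; rewrite ler_norml => /andP[? _]; lra.
split=> //.
have sb : 0 < Num.sqrt b by rewrite sqrtr_gt0.
have sy : Num.sqrt b <= Num.sqrt y by rewrite ler_sqrt //; lra.
have sv := sqrtr_ge0 v.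
rewrite mulrAC ler_pdivlMr //.
apply: le_trans vL.
have -> : v - y = (Num.sqrt v - Num.sqrt y) * (Num.sqrt v + Num.sqrt y).
  by rewrite -subr_sqr !sqr_sqrtr //; lra.
rewrite normrM; apply: ler_pM => //.
by rewrite ger0_norm; lra.
Qed.

(** The constants are chosen before [th], so they serve every predictor [j] at once. The size bound
    [M] accompanies the Lipschitz bound through the induction because products and quotients need
    it. *)
Lemma geval_stable (e : gexpr R s) (a b : R) : 0 < a -> 0 < b ->
  exists M L d0 : R, [/\ 0 < M, 0 < L, 0 < d0 & forall (th v : 'I_s -> R) d,
    (forall h, `|th h| <= a) -> gnondeg b e th -> 0 <= d -> d <= d0 ->
    (forall h, `|v h - th h| <= d) ->
    exists o u, [/\ geval e th = Some o, geval e v = Some u,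
                    `|o| <= M & `|u - o| <= L * d]].
Proof.
move=> a0 b0.
have minP (x y z : R) : z <= Num.min x y -> z <= x /\ z <= y.
  by rewrite le_min => /andP[].
elim: e => [i|r|e1 [M1 [L1 [d1 [M10 L10 d10 H1]]]] e2 [M2 [L2 [d2 [M20 L20 d20 H2]]]]
  |e1 [M1 [L1 [d1 [M10 L10 d10 H1]]]] e2 [M2 [L2 [d2 [M20 L20 d20 H2]]]]
  |e1 [M1 [L1 [d1 [M10 L10 d10 H1]]]] e2 [M2 [L2 [d2 [M20 L20 d20 H2]]]]
  |e1 [M1 [L1 [d1 [M10 L10 d10 H1]]]] e2 [M2 [L2 [d2 [M20 L20 d20 H2]]]]
  |e1 [M1 [L1 [d1 [M10 L10 d10 H1]]]]
  |e1 [M1 [L1 [d1 [M10 L10 d10 H1]]]]].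
- exists a, 1, 1; split=> // th v d tha _ dd0 dd1 hv.
  by exists (th i), (v i); split=> //; rewrite mul1r.
- have r1 : 0 < `|r| + 1 by rewrite ltr_wpDl.
  exists (`|r| + 1), 1, 1; split=> // th v d _ _ dd0 _ _.
  exists r, r; split=> //; first by rewrite lerDl.
  by rewrite subrr normr0 mul1r.
- exists (M1 + M2), (L1 + L2), (Num.min d1 d2).
  split; rewrite ?addr_gt0 ?lt_min ?d10 //.
  move=> th v d tha /= [n1 n2] dd0 /minP[dd1 dd2] hv.
  have [ o1 [ u1 [-> -> oM1 uL1]]] := H1 th v d tha n1 dd0 dd1 hv.
  have [ o2 [ u2 [-> -> oM2 uL2]]] := H2 th v d tha n2 dd0 dd2 hv.
  exists (o1 + o2), (u1 + u2); split=> //.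
    by apply: le_trans (ler_normD _ _) _; apply: lerD.
  have -> : u1 + u2 - (o1 + o2) = (u1 - o1) + (u2 - o2) by ring.
  by apply: le_trans (ler_normD _ _) _; rewrite mulrDl; apply: lerD.
- exists (M1 + M2), (L1 + L2), (Num.min d1 d2).
  split; rewrite ?addr_gt0 ?lt_min ?d10 //.
  move=> th v d tha /= [n1 n2] dd0 /minP[dd1 dd2] hv.
  have [ o1 [ u1 [-> -> oM1 uL1]]] := H1 th v d tha n1 dd0 dd1 hv.
  have [ o2 [ u2 [-> -> oM2 uL2]]] := H2 th v d tha n2 dd0 dd2 hv.
  exists (o1 - o2), (u1 - u2); split=> //.
    by apply: le_trans (ler_normB _ _) _; apply: lerD.
  have -> : u1 - u2 - (o1 - o2) = (u1 - o1) - (u2 - o2) by ring.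
  by apply: le_trans (ler_normB _ _) _; rewrite mulrDl; apply: lerD.
- exists (M1 * M2), (L1 * (M2 + L2 * d2) + M1 * L2), (Num.min d1 d2).
  split; rewrite ?addr_gt0 ?mulr_gt0 ?addr_gt0 ?mulr_gt0 ?lt_min ?d10 //.
  move=> th v d tha /= [n1 n2] dd0 /minP[dd1 dd2] hv.
  have [ o1 [ u1 [-> -> oM1 uL1]]] := H1 th v d tha n1 dd0 dd1 hv.
  have [ o2 [ u2 [-> -> oM2 uL2]]] := H2 th v d tha n2 dd0 dd2 hv.
  exists (o1 * o2), (u1 * u2); split=> //; first by rewrite normrM ler_pM.
  by apply: mulr_dist_le => //; apply: ltW.
(* A quotient is a product with an inverse, whose Lipschitz constant is [K2]. The threshold
   [b / 2 / L2] keeps the perturbed denominator away from 0. *)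
- have [K2 K2E K20] : exists2 K2, K2 = L2 * 2 / b ^+ 2 & 0 < K2.
    by eexists; first reflexivity; rewrite divr_gt0 ?mulr_gt0 ?exprn_gt0.
  have db0 : 0 < b / 2 / L2 by rewrite !divr_gt0.
  exists (M1 * b^-1), (L1 * (b^-1 + K2 * d2) + M1 * K2),
    (Num.min (Num.min d1 d2) (b / 2 / L2)).
  split; rewrite ?lt_min ?d10 ?d20 ?db0 ?addr_gt0 ?mulr_gt0 ?invr_gt0 //.
    by rewrite addr_gt0 ?invr_gt0 // mulr_gt0.
  move=> th v d tha /= [n1 n2 [y [ey yb]]] dd0 /minP[/minP[dd1 dd2] dd3] hv.
  have [ o1 [ u1 [-> -> oM1 uL1]]] := H1 th v d tha n1 dd0 dd1 hv.
  have [ o2 [ u2 [eo2 -> oM2 uL2]]] := H2 th v d tha n2 dd0 dd2 hv.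
  move: eo2; rewrite ey => -[yo2]; rewrite {}yo2 {y} in ey yb *.
  have Lb : L2 * d <= b / 2 by rewrite mulrC -ler_pdivlMr.
  have [u20 uK2] := invr_dist_le b0 yb uL2 Lb.
  rewrite -K2E in uK2.
  have o20 : o2 != 0 by rewrite -normr_gt0; apply: lt_le_trans yb.
  rewrite (negbTE u20) (negbTE o20); exists (o1 / o2), (u1 / u2).
  have ob : `|o2^-1| <= b^-1.
    by rewrite normfV lef_pV2 // posrE ?normr_gt0.
  split=> //; first by rewrite normrM ler_pM.
  by apply: mulr_dist_le => //; apply: ltW.
- exists M1, L1, d1; split=> // th v d tha /= n1 dd0 dd1 hv.
  have [ o1 [ u1 [-> -> oM1 uL1]]] := H1 th v d tha n1 dd0 dd1 hv.
  exists `|o1|, `|u1|; split; rewrite ?normr_id //.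
  exact: le_trans (ler_dist_dist _ _) uL1.
- have db0 : 0 < b / 2 / L1 by rewrite !divr_gt0.
  (* The size bound uses that the root of [t >= 0] is at most [t + 1]. *)
  exists (M1 + 1), (L1 / Num.sqrt b), (Num.min d1 (b / 2 / L1)).
  split; rewrite ?addr_gt0 ?divr_gt0 ?sqrtr_gt0 ?lt_min ?d10 //.
  move=> th v d tha /= [n1 [y [ey yb]]] dd0 /minP[dd1 dd3] hv.
  have [ o1 [ u1 [eo1 -> oM1 uL1]]] := H1 th v d tha n1 dd0 dd1 hv.
  move: eo1; rewrite ey => -[yo1]; rewrite {}yo1 {y} in ey yb *.
  have Lb : L1 * d <= b / 2 by rewrite mulrC -ler_pdivlMr.
  have [u10 uK1] := sqrtr_dist_le b0 yb uL1 Lb.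
  have o10 : 0 <= o1 by apply: le_trans yb; apply: ltW.
  rewrite !ltNge u10 o10 /=; exists (Num.sqrt o1), (Num.sqrt u1).
  split=> //; rewrite ger0_norm ?sqrtr_ge0 //.
  move: oM1; rewrite ger0_norm // -{1}(sqr_sqrtr o10).
  by have := sqrtr_ge0 o1; nra.
Qed.

End ExpressionStability.

(** * Measurability of evaluated expressions *)

Section ExpressionMeasurability.
Variables (R : realType) (s : nat) (d : measure_display) (T : measurableType d).

(** Writing the inverse as [y * (y^2)^(-1)] reduces it to a real power of a nonnegative base; at 0
    both sides vanish by convention. *)
Lemma measurable_invr : measurable_fun [set: R] (@GRing.inv R).
Proof.
have -> : @GRing.inv R = (fun y => y * (y ^+ 2) `^ (-1)).
  apply/funext => y; rewrite powR_inv1 ?sqr_ge0 //.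
  have [->|y0] := eqVneq y 0; first by rewrite invr0 mul0r.
  by rewrite expr2 invfM mulrA divff // mul1r.
apply: measurable_funM => //.
apply: (@measurableT_comp _ _ _ _ _ _ (fun x : R => x `^ (-1))).
  exact: measurable_powR.
exact: exprn_measurable.
Qed.

(** A partial function is handled as two total ones: the indicator of definedness and the value
    completed by 0. *)
Lemma measurable_geval (e : gexpr R s) (v : T -> 'I_s -> R) :
  (forall h, measurable_fun setT (v ^~ h)) ->
  measurable_fun setT (fun w => isSome (geval e (v w)) : bool) /\
  measurable_fun setT (fun w => odflt 0 (geval e (v w))).
Proof.
move=> mv.
(* One claim covers every binary node; [p] marks the second operands for which the operation is
   undefined. *)
have bin (f1 f2 : T -> option R) (op : R -> R -> R) (p : R -> bool) :
  measurable_fun setT (fun w => isSome (f1 w) : bool) ->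
  measurable_fun setT (fun w => odflt 0 (f1 w)) ->
  measurable_fun setT (fun w => isSome (f2 w) : bool) ->
  measurable_fun setT (fun w => odflt 0 (f2 w)) ->
  measurable_fun setT p ->
  (forall g1 g2 : T -> R, measurable_fun setT g1 -> measurable_fun setT g2 ->
     measurable_fun setT (fun w => op (g1 w) (g2 w))) ->
  let f w := match f1 w, f2 w with
    | Some x, Some y => if p y then None else Some (op x y) | _, _ => None end in
  measurable_fun setT (fun w => isSome (f w) : bool) /\
  measurable_fun setT (fun w => odflt 0 (f w)).
  move=> s1 v1 s2 v2 mp mop f.
  have mp' : measurable_fun setT (fun w => ~~ p (odflt 0 (f2 w))).
    by apply: measurable_neg; apply: measurableT_comp.
  have h1 : (fun w => isSome (f w) : bool) =
      (fun w => isSome (f1 w) && isSome (f2 w) && ~~ p (odflt 0 (f2 w))).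
    apply/funext => w; rewrite /f; case: (f1 w) => //= x; case: (f2 w) => //= y.
    by case: (p y).
  have m1 : measurable_fun setT (fun w => isSome (f w) : bool).
    by rewrite h1; apply: measurable_and => //; apply: measurable_and.
  split=> //.
  have -> : (fun w => odflt 0 (f w)) =
      (fun w => if isSome (f w) then op (odflt 0 (f1 w)) (odflt 0 (f2 w)) else 0).
    apply/funext => w; rewrite /f; case: (f1 w) => //= x; case: (f2 w) => //= y.
    by case: (p y).
  by apply: measurable_fun_ifT => //; apply: mop.
have bin0 (f1 f2 : T -> option R) (op : R -> R -> R) :=
  bin f1 f2 op (fun=> false).
elim: e => [i|r|e1 [s1 v1] e2 [s2 v2]|e1 [s1 v1] e2 [s2 v2]|e1 [s1 v1] e2 [s2 v2]
  |e1 [s1 v1] e2 [s2 v2]|e1 [s1 v1]|e1 [s1 v1]].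
- by split=> //=; apply: mv.
- by split.
- apply: (bin0 _ _ +%R) => // ? ?; exact: measurable_funD.
- apply: (bin0 _ _ (fun x y => x - y)) => // ? ?; exact: measurable_funB.
- apply: (bin0 _ _ *%R) => // ? ?; exact: measurable_funM.
- apply: (bin _ _ (fun x y => x / y) (fun y => y == 0)) => //.
    exact: measurable_fun_eqr.
  move=> g1 g2 m1 m2; apply: measurable_funM => //.
  by apply: (measurableT_comp measurable_invr).
- split.
    rewrite (_ : (fun w => _) = (fun w => isSome (geval e1 (v w)) : bool)) //.
    by apply/funext => w /=; case: geval.
  rewrite (_ : (fun w => _) = (fun w => `|odflt 0 (geval e1 (v w))|)).
    exact: measurableT_comp.
  by apply/funext => w /=; case: geval => //=; rewrite normr0.
(* The square root is recast as a binary node whose second operand is an always defined copy of the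
   first, tested for negativity. *)
- rewrite (_ : (fun w => isSome (geval (ESqrt e1) (v w))) = (fun w =>
      isSome (match geval e1 (v w), Some (odflt 0 (geval e1 (v w))) with
       Some x, Some y => if y < 0 then None else Some (Num.sqrt x) | _, _ => None end)));
    last by apply/funext => w /=; case: geval.
  rewrite (_ : (fun w => odflt 0 (geval (ESqrt e1) (v w))) = (fun w =>
      odflt 0 (match geval e1 (v w), Some (odflt 0 (geval e1 (v w))) with
       Some x, Some y => if y < 0 then None else Some (Num.sqrt x) | _, _ => None end)));
    last by apply/funext => w /=; case: geval.
  apply: (bin _ (fun w => Some (odflt 0 (geval e1 (v w))))
    (fun x y => Num.sqrt x) (fun y => y < 0)) => //.
    exact: measurable_fun_ltr.
  move=> g1 g2 m1 m2; apply: (measurableT_comp _ m1).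
  by apply: continuous_measurable_fun; exact: sqrt_continuous.
Qed.

End ExpressionMeasurability.

(** * Independence and products of expectations *)

Section Independence.
Context (R : realType) (d : measure_display) (T : measurableType d)
  (P : probability T R).

(** The measurable sets independent of [F] form a Dynkin system, so Dynkin's pi-lambda argument
    applies to the pi-system [G]. *)
Lemma indep_sigma_algebra (G : set (set T)) (F : set T) :
  setI_closed G -> G `<=` measurable -> measurable F ->
  (forall E, G E -> P (E `&` F) = (P E * P F)%E) ->
  forall E, <<s G >> E -> P (E `&` F) = (P E * P F)%E.
Proof.
move=> GI Gm mF h.
suff sub : <<s G >> `<=` [set E | measurable E /\ P (E `&` F) = (P E * P F)%E].
  by move=> E /sub[].
apply: lambda_system_subset => //; last by move=> E GE; split; [exact: Gm|exact: h].
apply/dynkin_lambda_system; split.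
- by split=> //; rewrite setTI probability_setT mul1e.
- move=> E [mE EF]; split; first exact: measurableC.
  have mEF : measurable (E `&` F) by apply: measurableI.
  rewrite probability_setC // setIC -setDE measureD //; last first.
    by rewrite ltey_eq fin_num_measure.
  transitivity (P F - P E * P F)%E; first by rewrite -EF setIC.
  by rewrite muleBl ?mul1e ?fin_num_measure.
- move=> E tE hE; have mE k : measurable (E k) by have [] := hE k.
  split; first exact: bigcupT_measurable.
  rewrite setI_bigcupl.
  have tEF : trivIset setT (fun k => E k `&` F).
    exact: trivIset_setIr.
  rewrite measure_semi_bigcup //; last 2 first.
  - by move=> k; apply: measurableI.
  - by apply: bigcupT_measurable => k; apply: measurableI.
  rewrite measure_semi_bigcup //; last exact: bigcupT_measurable.
  have PF : P F = (fine (P F))%:E by rewrite fineK ?fin_num_measure.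
  rewrite [RHS]muleC PF -nneseriesZl //.
  by apply: eq_eseriesr => k _; rewrite -PF [RHS]muleC -(hE k).2.
Qed.

(* Fubini for the joint law of f and g, which is the product of their laws. *)
Lemma integral_indepM (f g : T -> R) :
  measurable_fun setT f -> measurable_fun setT g ->
  (forall x, 0 <= f x) -> (forall x, 0 <= g x) ->
  (forall A B, measurable A -> measurable B ->
     P (f @^-1` A `&` g @^-1` B) = (P (f @^-1` A) * P (g @^-1` B))%E) ->
  (\int[P]_x (f x * g x)%:E = \int[P]_x (f x)%:E * \int[P]_x (g x)%:E)%E.
Proof.
move=> mf mg f0 g0 fg.
pose X : {mfun T >-> R} := HB.pack f (isMeasurableFun.Build _ _ _ _ _ mf).
pose Y : {mfun T >-> R} := HB.pack g (isMeasurableFun.Build _ _ _ _ _ mg).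
have mXY : measurable_fun setT (fun x => (f x, g x)) by apply: measurable_fun_pair.
pose XY : {mfun T >-> (R * R)%type} :=
  HB.pack (fun x => (f x, g x)) (isMeasurableFun.Build _ _ _ _ _ mXY).
pose m1 := distribution P X; pose m2 := distribution P Y; pose m := distribution P XY.
have mE : forall A : set (R * R), measurable A -> (m1 \x m2)%E A = m A.
  apply: product_measure_unique => A B mA mB /=.
  by rewrite /m /m1 /m2 /distribution /pushforward /= -fg.
have mnorm : measurable_fun setT (fun x : R => `|x|%:E).
  by apply/measurable_EFinP.
have mprod : measurable_fun setT (fun z : R * R => (`|z.1| * `|z.2|)%:E).
  by apply/measurable_EFinP; apply: measurable_funM; apply: measurableT_comp.
(* The absolute values make the integrand nonnegative on the whole plane, as Tonelli requires,
   without changing it on the values of [(f, g)]. *)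
transitivity (\int[m]_z (`|z.1| * `|z.2|)%:E)%E.
  rewrite ge0_integral_distribution //.
  by apply: eq_integral => x _ /=; rewrite !ger0_norm.
transitivity (\int[(m1 \x m2)%E]_z (`|z.1| * `|z.2|)%:E)%E.
  by apply: eq_measure_integral => A mA _; apply/esym; exact: mE.
rewrite fubini_tonelli1 //.
rewrite /fubini_F /=.
under eq_integral do under eq_integral do rewrite EFinM.
have -> : (\int[P]_x (g x)%:E = \int[m2]_y `|y|%:E)%E.
  by rewrite ge0_integral_distribution //; apply: eq_integral => x _ /=; rewrite ger0_norm.
have -> : (\int[P]_x (f x)%:E = \int[m1]_y `|y|%:E)%E.
  by rewrite ge0_integral_distribution //; apply: eq_integral => x _ /=; rewrite ger0_norm.
under eq_integral do rewrite ge0_integralZl //.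
by rewrite ge0_integralZr // integral_ge0.
Qed.

Context (dU : measure_display) (U : measurableType dU) (N : nat)
  (Z : 'I_N -> T -> U).

(** A pi-system generating the sigma-algebra of the [Z i] with [i] in [A]. The intersection runs
    over all indices, with trivial factors outside [A], to match the form of [indepZ]. *)
Definition cylinders (A : {set 'I_N}) : set (set T) :=
  [set E | exists B : 'I_N -> set U, [/\ forall i, measurable (B i),
     forall i, i \notin A -> B i = setT &
     E = \bigcap_(i in [set: 'I_N]) (Z i @^-1` B i)]].

(* measurability with respect to the sigma-algebra generated by Z i, i in A *)
Definition depends_on (A : {set 'I_N}) (f : T -> R) : Prop :=
  measurable_fun setT (f : g_sigma_algebraType (cylinders A) -> R).

Hypothesis mZ : forall i, measurable_fun setT (Z i).
Hypothesis indepZ : forall B : 'I_N -> set U, (forall i, measurable (B i)) ->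
  P (\bigcap_(i in [set: 'I_N]) (Z i @^-1` B i)) =
  (\prod_(i < N) P (Z i @^-1` B i))%E.

Implicit Types A B : {set 'I_N}.

Lemma cylinders_setI_closed A : setI_closed (cylinders A).
Proof.
move=> E F [B [mB BA ->]] [C [mC CA ->]].
exists (fun i => B i `&` C i); split.
- by move=> i; apply: measurableI.
- by move=> i iA; rewrite BA // CA // setTI.
- by rewrite -bigcapI.
Qed.

Lemma cylinders_measurable A : cylinders A `<=` measurable.
Proof.
move=> E [B [mB _ ->]]; apply: fin_bigcap_measurable => // i _.
by rewrite -[X in measurable X]setTI; apply: mZ.
Qed.

Lemma sigma_cylinders_measurable A : <<s cylinders A >> `<=` measurable.
Proof.
apply: smallest_sub; first exact: sigma_algebra_measurable.
exact: cylinders_measurable.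
Qed.

Lemma cylinders_mono A B : A \subset B -> cylinders A `<=` cylinders B.
Proof.
move=> /fintype.subsetP AB E [C [mC CA ->]]; exists C; split=> // i iB.
by apply: CA; apply: contra iB; apply: AB.
Qed.

(** The intersection is the cylinder with factors [C i] and [D i] intersected, and at each index at
    least one of the two is the whole space. *)
Lemma cylinders_indep A B E F : [disjoint A & B]%B ->
  cylinders A E -> cylinders B F -> P (E `&` F) = (P E * P F)%E.
Proof.
move=> dAB [C [mC CA ->]] [D [mD DB ->]].
rewrite -bigcapI (@indepZ C) // (@indepZ D) // (@indepZ (fun i => C i `&` D i)); last first.
  by move=> i; apply: measurableI.
rewrite -big_split /=; apply: eq_bigr => i _.
have [iA|iA] := boolP (i \in A); last first.
  by rewrite CA // setTI preimage_setT probability_setT mul1e.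
by rewrite DB ?(disjointFr dAB iA) // setIT preimage_setT probability_setT mule1.
Qed.

(** The pi-lambda argument is run twice, once in each event with the other one fixed. *)
Lemma sigma_cylinders_indep A B E F : [disjoint A & B]%B ->
  <<s cylinders A >> E -> <<s cylinders B >> F -> P (E `&` F) = (P E * P F)%E.
Proof.
move=> dAB EA FB.
apply: (@indep_sigma_algebra (cylinders A)) => //.
- exact: cylinders_setI_closed.
- exact: cylinders_measurable.
- exact: sigma_cylinders_measurable FB.
move=> {EA}E EA; rewrite setIC muleC.
apply: (@indep_sigma_algebra (cylinders B)) => //.
- exact: cylinders_setI_closed.
- exact: cylinders_measurable.
- exact: cylinders_measurable EA.
move=> {FB}F FB; rewrite setIC muleC.
exact: (cylinders_indep dAB).
Qed.

Lemma depends_on_measurable A f : depends_on A f -> measurable_fun setT f.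
Proof.
move=> mf _ Y mY; apply: (@sigma_cylinders_measurable A).
exact: (mf measurableT Y mY).
Qed.

Lemma depends_on_mono A B f : A \subset B -> depends_on A f -> depends_on B f.
Proof.
move=> AB mf _ Y mY.
have := mf measurableT Y mY.
apply: sub_smallest2r; first exact: smallest_sigma_algebra.
exact: cylinders_mono.
Qed.

Lemma measurable_cylinders A i : i \in A ->
  measurable_fun setT (Z i : g_sigma_algebraType (cylinders A) -> U).
Proof.
move=> iA _ Y mY; apply: sub_sigma_algebra.
exists (fun k => if k == i then Y else setT); split.
- by move=> k; case: ifP.
- by move=> k kA; case: ifP => // /eqP ki; rewrite ki iA in kA.
- rewrite setTI; apply/seteqP; split=> [w Yw k _ /=|w /(_ i Logic.I) /=].
    by case: eqP => // ->.
  by rewrite eqxx.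
Qed.

Lemma integral_depends_onM A B f g : [disjoint A & B]%B ->
  depends_on A f -> depends_on B g -> (forall x, 0 <= f x) -> (forall x, 0 <= g x) ->
  (\int[P]_x (f x * g x)%:E = \int[P]_x (f x)%:E * \int[P]_x (g x)%:E)%E.
Proof.
move=> dAB fA gB f0 g0; apply: integral_indepM => //.
- exact: depends_on_measurable fA.
- exact: depends_on_measurable gB.
move=> C D mC mD; apply: (sigma_cylinders_indep dAB).
- by rewrite -[X in <<s _ >> X]setTI; exact: (fA measurableT C mC).
- by rewrite -[X in <<s _ >> X]setTI; exact: (gB measurableT D mD).
Qed.

Lemma integral_depends_on_prod (I : eqType) (r : seq I) (A : I -> {set 'I_N})
    (f : I -> T -> R) :
  uniq r ->
  (forall q q', q \in r -> q' \in r -> q != q' -> [disjoint A q & A q']%B) ->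
  (forall q, q \in r -> depends_on (A q) (f q)) -> (forall q x, 0 <= f q x) ->
  (\int[P]_x (\prod_(q <- r) f q x)%:E = \prod_(q <- r) \int[P]_x (f q x)%:E)%E.
Proof.
move=> ur dA fA f0.
(* The induction also records that the partial product depends only on the union of its blocks,
   which is disjoint from the next block. *)
suff [] : depends_on (\bigcup_(q <- r) A q)%SET (fun x => \prod_(q <- r) f q x) /\
  (\int[P]_x (\prod_(q <- r) f q x)%:E = \prod_(q <- r) \int[P]_x (f q x)%:E)%E by [].
elim: r ur dA fA => [|q r IH] /=.
  move=> _ _ _; split.
    rewrite (_ : (fun x => _) = cst 1); first exact: measurable_cst.
    by apply/funext => x; rewrite big_nil.
  rewrite big_nil (eq_integral (cst 1%E)).
    by rewrite integral_cst // mul1e; exact: probability_setT.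
  by move=> x _; rewrite big_nil.
move=> /andP[qr ur] dA fA.
have [|||IH1 IH2] := IH.
- by [].
- by move=> i j ir jr; apply: dA; rewrite inE ?ir ?jr orbT.
- by move=> i ir; apply: fA; rewrite inE ir orbT.
have fq : depends_on (A q) (f q) by apply: fA; rewrite mem_head.
have prodE x : \prod_(i <- q :: r) f i x = f q x * \prod_(i <- r) f i x.
  by rewrite big_cons.
have dq : [disjoint A q & (\bigcup_(q <- r) A q)%SET]%B.
  rewrite big_seq; elim/big_ind: _ => [|B C dB dC|i ir].
  - by rewrite disjoint_sym; apply/pred0P => k /=; rewrite inE.
  - by rewrite -finset.setI_eq0 finset.setIUr finset.setU_eq0 !finset.setI_eq0 dB.
  - apply: dA; rewrite ?mem_head // ?inE ?ir ?orbT //.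
    by apply: contraNneq qr => ->.
split.
  rewrite big_cons (_ : (fun x => _) = (f q \* (fun x => \prod_(i <- r) f i x))).
    apply: measurable_funM.
      by apply: depends_on_mono fq; apply: finset.subsetUl.
    by apply: depends_on_mono IH1; apply: finset.subsetUr.
  exact/funext.
rewrite big_cons -IH2 -(integral_depends_onM dq) //.
- by apply: eq_integral => x _; rewrite prodE.
- by move=> x; apply: prodr_ge0.
Qed.

End Independence.

(** * Measurability of evaluated kernels *)

Section Kernels.
Variables (R : realType) (d : measure_display) (T : measurableType d) (N p : nat).

Lemma measurable_kern_at (Z : 'I_N -> T -> R * p.-tuple R) (k : nat)
    (ker : k.-tuple (R * R) -> R) (j : 'I_p) (t : k.-tuple 'I_N) :
  measurable_fun setT ker -> (forall i, i \in t -> measurable_fun setT (Z i)) ->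
  measurable_fun setT (kern_at Z ker j t).
Proof.
move=> mker mZ; apply: (measurableT_comp mker).
apply/measurable_fun_tnthP => q.
rewrite (_ : _ \o _ = Zpair Z (tnth t q) j).
  have mZq := mZ _ (mem_tnth q t).
  apply: measurable_fun_pair; first exact: measurableT_comp.
  apply: (@measurableT_comp _ _ _ _ _ _ (fun x : p.-tuple R => tnth x j)).
    exact: measurable_tnth.
  exact: measurableT_comp.
apply/funext => w /=; rewrite (tnth_nth (0, 0)) /to_tuple val_insubd size_map.
by rewrite size_tuple eqxx (nth_map (tnth t q)) ?size_tuple // -tnth_nth.
Qed.

End Kernels.

(** * Laplace transform of one centred kernel, and Markov's inequality *)

Section Moments.
Context (R : realType) (d : measure_display) (T : measurableType d)
  (P : probability T R).

(** With [z = kappa (|x| + a) / 2], the quadratic remainder is at most [lam^2 (|x| + a)^2 e^z], and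
    [(|x| + a)^2 = 4 z^2 / kappa^2 <= 8 e^z / kappa^2]; finally [e^(2 z)] splits into [e^(kappa a)]
    and [e^(kappa |x|)]. The right side is grouped so as to be integrated by linearity. *)
Lemma mgf_bound_pointwise (kappa a x th lam : R) : 0 < kappa -> `|th| <= a ->
  `|lam| <= kappa / 2 ->
  expR (lam * (x - th)) <= (1 - lam * th) + (lam * x +
    (lam ^+ 2 * (8 / kappa ^+ 2 * expR (kappa * a))) * expR (kappa * `|x|)).
Proof.
move=> k0 tha laml.
set y := lam * (x - th); set z := kappa / 2 * (`|x| + a).
have a0 : 0 <= a by apply: le_trans tha.
have xa : `|x - th| <= `|x| + a.
  by apply: le_trans (ler_normB _ _) _; rewrite lerD2l.
have z0 : 0 <= z by rewrite mulr_ge0 ?addr_ge0 // divr_ge0 // ltW.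
have yz : `|y| <= z by rewrite normrM ler_pM.
apply: le_trans (expR_le_quadratic y) _.
have -> : 1 + y + y ^+ 2 * expR `|y| =
  1 - lam * th + (lam * x + y ^+ 2 * expR `|y|) by rewrite /y; ring.
rewrite !lerD2l.
have -> : lam ^+ 2 * (8 / kappa ^+ 2 * expR (kappa * a)) * expR (kappa * `|x|) =
  (lam ^+ 2 * (4 / kappa ^+ 2 * (2 * expR z))) * expR z.
  have -> : expR z = expR (kappa * a / 2) * expR (kappa * `|x| / 2).
    by rewrite -expRD; congr expR; rewrite /z; field.
  rewrite {1}(_ : kappa * a = kappa * a / 2 + kappa * a / 2); last by field.
  rewrite {1}(_ : kappa * `|x| = kappa * `|x| / 2 + kappa * `|x| / 2); last by field.
  by rewrite !expRD; field; rewrite gt_eqF.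
apply: ler_pM; rewrite ?sqr_ge0 ?expR_ge0 ?ler_expR //.
rewrite exprMn ler_wpM2l ?sqr_ge0 //.
have : 4 / kappa ^+ 2 * z ^+ 2 <= 4 / kappa ^+ 2 * (2 * expR z).
  by rewrite ler_wpM2l ?divr_ge0 ?sqr_ge0 // sqr_le_expR.
apply: le_trans.
have -> : 4 / kappa ^+ 2 * z ^+ 2 = (`|x| + a) ^+ 2.
  by rewrite /z; field; rewrite gt_eqF.
by rewrite -[leLHS]real_normK ?num_real // ler_sqr ?nnegrE ?addr_ge0.
Qed.

(** Integrating the pointwise bound, the terms linear in [lam] cancel because the mean is [th].
    Taking [|K|] keeps the quadratic coefficient nonnegative with no assumption on the sign of
    [K]. *)
Lemma mgf_bound (X : T -> R) (kappa K a th lam : R) :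
  measurable_fun setT X -> 0 < kappa -> `|th| <= a -> `|lam| <= kappa / 2 ->
  ('E_P[X] = th%:E)%E ->
  ('E_P[fun w => expR (kappa * `|X w|)] <= K%:E)%E ->
  (\int[P]_w (expR (lam * (X w - th)))%:E <=
   (1 + lam ^+ 2 * (8 / kappa ^+ 2 * expR (kappa * a) * `|K|))%:E)%E.
Proof.
move=> mX k0 tha laml; rewrite unlock => EX EK.
have mE : measurable_fun setT (fun w => expR (kappa * `|X w|)).
  apply: measurableT_comp => //; apply: measurable_funM => //.
  exact: measurableT_comp.
have iE : P.-integrable setT (fun w => (expR (kappa * `|X w|))%:E).
  apply/integrableP; split; first exact/measurable_EFinP.
  under eq_integral do rewrite gee0_abs ?lee_fin ?expR_ge0 //.
  exact: le_lt_trans EK (ltry _).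
(* The exponential moment dominates the first one: [|X| <= e^(kappa |X|) / kappa]. *)
have iX : P.-integrable setT (fun w => (X w)%:E).
  apply: (le_integrable measurableT _ _ (integrableZl measurableT kappa^-1 iE)).
    exact/measurable_EFinP.
  move=> w _ /=; rewrite lee_fin [leRHS]ger0_norm; last first.
    by rewrite mulr_ge0 ?expR_ge0 // invr_ge0 ltW.
  rewrite ler_pdivlMl //.
  by have := expR_ge1Dx (kappa * `|X w|); lra.
pose c := lam ^+ 2 * (8 / kappa ^+ 2 * expR (kappa * a)).
have c0 : 0 <= c.
  by rewrite mulr_ge0 ?sqr_ge0 // mulr_ge0 ?expR_ge0 ?divr_ge0 ?sqr_ge0.
apply: (@le_trans _ _ (\int[P]_w ((1 - lam * th)%:E +
   (lam%:E * (X w)%:E + c%:E * (expR (kappa * `|X w|))%:E)))%E).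
  apply: ge0_le_integral => //.
  - apply/measurable_EFinP; apply: measurableT_comp => //.
    by apply: measurable_funM => //; apply: measurable_funB.
  - apply: emeasurable_funD => //; apply: emeasurable_funD.
      by apply: emeasurable_funM => //; apply/measurable_EFinP.
    by apply: emeasurable_funM => //; apply/measurable_EFinP.
  - by move=> w _; rewrite -!EFinM -!EFinD lee_fin; apply: mgf_bound_pointwise.
rewrite integralD //; last 2 first.
- exact: finite_measure_integrable_cst.
- by apply: integrableD => //; apply: integrableZl.
rewrite integralD //; try by apply: integrableZl.
have -> : (\int[P]_w (1 - lam * th)%:E = (1 - lam * th)%:E)%E.
  by have := expectation_cst P (1 - lam * th); rewrite unlock.
rewrite !integralZl // EX -EFinM addeA -EFinD subrK.
have cK : (c%:E * \int[P]_w (expR (kappa * `|X w|))%:E <= (c * `|K|)%:E)%E.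
  rewrite [(c * `|K|)%:E]EFinM; apply: lee_wpmul2l; first by rewrite lee_fin.
  by apply: le_trans EK _; rewrite lee_fin ler_norm.
rewrite EFinD; apply: leeD => //.
by rewrite mulrA.
Qed.

Lemma markov_ge0 (f : T -> R) (c : R) : measurable_fun setT f ->
  (forall x, 0 <= f x) -> 0 < c ->
  (P [set x | (c <= f x)%R] <= c^-1%:E * \int[P]_x (f x)%:E)%E.
Proof.
move=> mf f0 c0.
pose X : {mfun T >-> R} := HB.pack f (isMeasurableFun.Build _ _ _ _ _ mf).
have := @markov _ _ _ P X id c c0 (@measurable_id _ _ _) (fun r r0 => r0).
rewrite unlock /= => /(_ (fun x y _ _ h => h)).
rewrite (_ : [set x | _] = [set x | c <= f x]); last first.
  by apply/seteqP; split=> x /=; rewrite lee_fin ger0_norm.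
rewrite (eq_integral (fun x => (f x)%:E)); last by move=> x _ /=; rewrite ger0_norm.
by rewrite lee_pdivlMl.
Qed.

End Moments.

(** * Laplace transforms of local and aggregated U-statistics *)

Lemma prode_le_pow (R : realType) (I : eqType) (s : seq I) (f : I -> \bar R) (phi : R) :
  0 <= phi -> (forall i, i \in s -> (0 <= f i)%E /\ (f i <= phi%:E)%E) ->
  (\prod_(i <- s) f i <= (phi ^+ size s)%:E)%E.
Proof.
move=> phi0 h.
suff [] : (0 <= \prod_(i <- s) f i)%E /\ (\prod_(i <- s) f i <= (phi ^+ size s)%:E)%E by [].
elim: s h => [|i s IH] h; first by rewrite big_nil expr0; split.
have [|IH0 IH1] := IH; first by move=> k ks; apply: h; rewrite inE ks orbT.
have [f0 f1] := h i (mem_head _ _).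
rewrite big_cons exprS EFinM; split; first exact: mule_ge0.
by apply: lee_pmul.
Qed.

Section UStatisticMGF.
Context (R : realType) (d : measure_display) (T : measurableType d)
  (P : probability T R) (dU : measure_display) (U : measurableType dU) (N : nat)
  (Z : 'I_N -> T -> U).
Hypothesis mZ : forall i, measurable_fun setT (Z i).
Hypothesis indepZ : forall B : 'I_N -> set U, (forall i, measurable (B i)) ->
  P (\bigcap_(i in [set: 'I_N]) (Z i @^-1` B i)) =
  (\prod_(i < N) P (Z i @^-1` B i))%E.

Local Notation depends_on := (@depends_on R d T dU U N Z).

Variables (k : nat) (G : {set 'I_N} -> T -> R) (th lam phi : R).
Hypothesis dG : forall A : {set 'I_N}, #|A| = k -> depends_on A (G A).
Hypothesis phi0 : 0 <= phi.
Hypothesis mgfG : forall A : {set 'I_N}, #|A| = k ->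
  (\int[P]_x (expR (lam * (G A x - th)))%:E <= phi%:E)%E.

(** An abstract local U-statistic: the summands are indexed by [k]-subsets, and all that is asked of
    [G A] is dependence on the data in [A] and a Laplace bound. *)
Definition subset_mean (S : {set 'I_N}) (x : T) : R :=
  ('C(#|S|, k)%:R)^-1 *
  \sum_(A : {set 'I_N} | (A \subset S) && (#|A| == k)) G A x.

Lemma depends_on_subset_mean S : depends_on S (subset_mean S).
Proof.
rewrite (_ : subset_mean S = fun x => ('C(#|S|, k)%:R)^-1 *
    \sum_(A : {set 'I_N}) if (A \subset S) && (#|A| == k) then G A x else 0).
  apply: measurable_funM => //.
  apply: measurable_sum => A; case: (boolP ((A \subset S) && _)) => // /andP[AS /eqP cA].
  by apply: depends_on_mono (dG cA).
by apply/funext => x; rewrite /subset_mean big_mkcond.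
Qed.

Lemma depends_on_mgf A X : depends_on A X ->
  depends_on A (fun x => expR (lam * (X x - th))).
Proof.
move=> mX; apply: measurableT_comp => //; apply: measurable_funM => //.
exact: measurable_funB.
Qed.

(* Hoeffding's representation: the mean over all k-subsets of S is an average,
   over the permutations u of S, of means over the r disjoint blocks u @: B q. *)
Lemma subset_mean_mgf (S : {set 'I_N}) r : (k <= #|S|)%N -> (r * k <= #|S|)%N ->
  (\int[P]_x (expR ((lam * r%:R) * (subset_mean S x - th)))%:E <= (phi ^+ r)%:E)%E.
Proof.
move=> kS rkS.
have [B [B1 B2]] := disjoint_blocks_ex rkS.
pose pr := [pred u : {perm 'I_N} | perm_on S u].
have pr0 : (0 < #|pr|)%N.
  by apply/card_gt0P; exists 1%g; rewrite inE; exact: perm_on1.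
have prR : #|pr|%:R != 0 :> R by rewrite pnatr_eq0 -lt0n.
have C0 : 'C(#|S|, k)%:R != 0 :> R by rewrite pnatr_eq0 -lt0n bin_gt0.
pose F (u : {perm 'I_N}) x := \sum_(q < r) lam * (G (u @: B q) x - th).
(* Each block [B q] has a uniformly distributed image under a random permutation of [S], so it
   contributes [lam] times the centred mean; the [r] blocks give the factor [r]. *)
have FE x : lam * r%:R * (subset_mean S x - th) = #|pr|%:R^-1 * \sum_(u | pr u) F u x.
  have E (q : 'I_r) : \sum_(u | pr u) (lam * (G (u @: B q) x - th)) =
      #|pr|%:R * (lam * (subset_mean S x - th)).
    have [Bq1 Bq2] := B1 q (ltn_ord q).
    rewrite -big_distrr /= sumrB sumr_const -[th *+ _]mulr_natr.
    have := sum_perm_on_imset (fun A => G A x) Bq1 Bq2.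
    rewrite -[LHS]mulr_natr -[RHS]mulr_natr => /(canRL (mulfK C0)) ->.
    by rewrite /subset_mean; ring.
  rewrite /F exchange_big /= (eq_bigr _ (fun q _ => E q)) sumr_const card_ord.
  by rewrite -mulr_natr; field.
pose H (u : {perm 'I_N}) x := \prod_(q <- enum 'I_r) expR (lam * (G (u @: B q) x - th)).
have FH u x : expR (F u x) = H u x by rewrite /F /H expR_sum big_enum.
have dB (u : {perm 'I_N}) (q : 'I_r) : #|u @: B q| = k.
  by rewrite card_imset; [have [] := B1 q (ltn_ord q)|exact: perm_inj].
have H0 u x : 0 <= H u x by apply: prodr_ge0 => q _; apply: expR_ge0.
have mH u : measurable_fun setT (H u).
  apply: measurable_prod => q _.
  by apply: (depends_on_measurable mZ (depends_on_mgf (dG (dB u q)))).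
have IH u : (\int[P]_x (H u x)%:E <= (phi ^+ r)%:E)%E.
  rewrite (integral_depends_on_prod mZ indepZ (A := fun q : 'I_r => u @: B q)) //.
  - rewrite -[X in _ ^+ X](size_enum_ord r).
    apply: prode_le_pow => // q _; split; last exact: mgfG.
    by apply: integral_ge0 => x _; rewrite lee_fin expR_ge0.
  - exact: enum_uniq.
  (* Permutations are injective, so the images of disjoint blocks stay disjoint. *)
  - move=> q q' _ _ qq'; rewrite -finset.setI_eq0 -imsetI; last first.
      by move=> ? ? _ _; exact: perm_inj.
    rewrite imset_eq0 finset.setI_eq0; apply: B2 => //.
  - by move=> q _; apply: depends_on_mgf; apply: dG.
(* Jensen moves the average over permutations outside the exponential; each term is then a product
   of [r] independent factors. *)
apply: (@le_trans _ _ (\int[P]_x (#|pr|%:R^-1%:E *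
    \sum_(u <- [seq u <- index_enum _ | pr u]) (H u x)%:E))%E).
  apply: ge0_le_integral => //.
  - apply/measurable_EFinP; apply: measurableT_comp => //; apply: measurable_funM => //.
    apply: measurable_funB => //.
    apply: (depends_on_measurable mZ (A := S)).
    exact: depends_on_subset_mean.
  - apply: emeasurable_funM => //; apply: emeasurable_sum => u.
    exact/measurable_EFinP.
  - move=> x _; rewrite sumEFin -EFinM lee_fin FE big_filter.
    rewrite -(eq_bigr _ (fun u _ => FH u x)).
    exact: (@jensen_expR R _ pr (fun u => F u x) pr0).
rewrite ge0_integralZl_EFin //; first last.
- by apply: emeasurable_sum => u; exact/measurable_EFinP.
- by move=> x _; apply: sume_ge0 => u _; rewrite lee_fin.
rewrite ge0_integral_sum //; first last.
- by move=> u x _; rewrite lee_fin.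
- by move=> u; exact/measurable_EFinP.
have : (\sum_(u <- [seq u <- index_enum _ | pr u]) \int[P]_x (H u x)%:E <=
   \sum_(u <- [seq u <- index_enum _ | pr u]) (phi ^+ r)%:E)%E by apply: lee_sum.
rewrite sumEFin !big_filter sumr_const => h.
apply: le_trans (lee_wpmul2l _ h) _; first by rewrite lee_fin invr_ge0.
by rewrite -EFinM lee_fin -[_ *+ #|_|]mulr_natl mulrA mulVf // mul1r.
Qed.

(** The scale [m * r] cancels the average over [l], so the exponential factors into one term per
    block [Sb l]. These are independent, each with Laplace bound [phi ^+ r]. *)
Lemma mean_subset_mean_mgf (m : nat) (Sb : 'I_m -> {set 'I_N}) r :
  (0 < m)%N ->
  (forall l, (k <= #|Sb l|)%N) -> (forall l, (r * k <= #|Sb l|)%N) ->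
  (forall l l', l != l' -> [disjoint Sb l & Sb l']%B) ->
  (\int[P]_x (expR (lam * (m * r)%:R *
     (m%:R^-1 * \sum_(l < m) subset_mean (Sb l) x - th)))%:E <= (phi ^+ (m * r))%:E)%E.
Proof.
move=> m0 kS rkS dS.
have mR : m%:R != 0 :> R by rewrite pnatr_eq0 -lt0n.
rewrite (eq_integral (fun x => (\prod_(l <- enum 'I_m)
    expR (lam * r%:R * (subset_mean (Sb l) x - th)))%:E)); last first.
  move=> x _; rewrite big_enum -expR_sum -big_distrr /= sumrB sumr_const card_ord.
  by rewrite -[th *+ _]mulr_natr natrM; congr (expR _)%:E; field.
rewrite (integral_depends_on_prod mZ indepZ (A := Sb)) //.
- rewrite mulnC exprM -[X in _ ^+ X](size_enum_ord m).
  apply: prode_le_pow => [|l _]; first exact: exprn_ge0.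
  split; last exact: subset_mean_mgf.
  by apply: integral_ge0 => x _; rewrite lee_fin expR_ge0.
- exact: enum_uniq.
- by move=> l l' _ _; apply: dS.
- move=> l _; apply: measurableT_comp => //; apply: measurable_funM => //.
  by apply: measurable_funB => //; exact: depends_on_subset_mean.
Qed.

End UStatisticMGF.

(** * Chernoff and union bounds *)

Lemma measurable_ge_set (R : realType) (d : measure_display) (T : measurableType d)
    (f : T -> R) (c : R) :
  measurable_fun setT f -> measurable [set x | c <= f x].
Proof.
move=> mf; rewrite -[X in measurable X]setTI.
exact: (@measurable_fun_ler _ _ _ _ (cst c) f _ mf measurableT [set true]).
Qed.

Section Tails.
Context (R : realType) (d : measure_display) (T : measurableType d)
  (P : probability T R).

(** Markov's inequality at parameter [lam * M], where [M] counts the independent kernels; the two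
    tails are the events [E lam] and [E (- lam)]. *)
Lemma chernoff_two_sided (X : T -> R) (th lam eps phi : R) (M : nat) :
  measurable_fun setT X -> 0 <= lam ->
  (\int[P]_x (expR (lam * M%:R * (X x - th)))%:E <= (phi ^+ M)%:E)%E ->
  (\int[P]_x (expR (- lam * M%:R * (X x - th)))%:E <= (phi ^+ M)%:E)%E ->
  (P [set x | (eps <= `|X x - th|)%R] <=
    (2 * (expR (- (lam * eps)) * phi) ^+ M)%:E)%E.
Proof.
move=> mX lam0 up lo.
have lM0 : 0 <= lam * M%:R by rewrite mulr_ge0.
pose E (sg : R) := [set x | expR (lam * M%:R * eps) <= expR (sg * M%:R * (X x - th))].
have mexp sg : measurable_fun setT (fun x => expR (sg * M%:R * (X x - th))).
  apply: measurableT_comp => //; apply: measurable_funM => //.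
  exact: measurable_funB.
have bd sg : (\int[P]_x (expR (sg * M%:R * (X x - th)))%:E <= (phi ^+ M)%:E)%E ->
    (P (E sg) <= ((expR (- (lam * eps)) * phi) ^+ M)%:E)%E.
  move=> h; apply: le_trans (markov_ge0 P (mexp sg) _ _) _.
  - by move=> x; apply: expR_ge0.
  - exact: expR_gt0.
  rewrite exprMn EFinM -expRM_natr -expRN.
  have -> : - (lam * M%:R * eps) = - (lam * eps) * M%:R by ring.
  by apply: lee_wpmul2l => //; rewrite lee_fin expR_ge0.
apply: (@le_trans _ _ (P (E lam `|` E (- lam)))).
  apply: le_measure; rewrite ?inE.
  - by apply: measurable_ge_set; apply: measurableT_comp => //; apply: measurable_funB.
  - by apply: measurableU; apply: measurable_ge_set.
  move=> x /= ex; rewrite /E /= !ler_expR mulNr mulNr -mulrN.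
  have := ler_wpM2l lM0 ex.
  case: (lerP 0 (X x - th)) => x0 h.
    by left; rewrite ger0_norm // in h.
  by right; rewrite ltr0_norm // in h.
apply: le_trans (measureU2 _ _ _) _.
- exact: measurable_ge_set.
- exact: measurable_ge_set.
rewrite mulr2n mulrDl mul1r EFinD.
by apply: leeD; apply: bd.
Qed.

Lemma measure_bigsetU_le (I : Type) (r : seq I) (F : I -> set T) :
  (forall i, measurable (F i)) ->
  (P (\big[setU/set0]_(i <- r) F i) <= \sum_(i <- r) P (F i))%E.
Proof.
move=> mF; elim: r => [|i r IH]; first by rewrite !big_nil measure0.
rewrite !big_cons; apply: le_trans (measureU2 _ _ _) _ => //.
  exact: bigsetU_measurable.
exact: leeD.
Qed.

End Tails.

(** The Chernoff parameter is [eps / D]. Bounding [1 + t] by [e^t] leaves the exponent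
    [- eps^2 / D + C eps^2 / D^2], which is at most [- eps^2 / (2 D)], and the exponential is then
    linearised. *)
Lemma chernoff_rate (R : realType) (kappa C eps0 : R) :
  0 < kappa -> 0 <= C -> 0 < eps0 ->
  exists2 D : R, 0 < D & forall eps, 0 < eps -> eps <= eps0 ->
    eps / D <= kappa / 2 /\
    expR (- (eps / D * eps)) * (1 + (eps / D) ^+ 2 * C) <= 1 - eps ^+ 2 / (4 * D).
Proof.
move=> k0 C0 e0.
(* The summands of [D] serve in turn to absorb the quadratic term, to have [eps^2 / (2 D) <= 1] for
   the linearisation, and to keep [eps / D] below [kappa / 2]. *)
exists (2 * C + eps0 ^+ 2 + 2 * eps0 / kappa).
  have h1 : 0 < 2 * eps0 / kappa by rewrite divr_gt0 ?mulr_gt0.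
  by have h2 := sqr_ge0 eps0; lra.
set q := 2 * eps0 / kappa; set D := 2 * C + eps0 ^+ 2 + q => eps eps_gt0 epsle.
have q0 : 0 < q by rewrite divr_gt0 ?mulr_gt0.
have e02 : 0 < eps0 ^+ 2 by rewrite exprn_gt0.
have DE : D = 2 * C + eps0 ^+ 2 + q by [].
have D0 : 0 < D by rewrite DE; lra.
have eps2 : eps ^+ 2 <= eps0 ^+ 2 by rewrite ler_sqr ?nnegrE //; apply: ltW.
have Dn : D != 0 by rewrite gt_eqF.
split.
  rewrite ler_pdivrMr //; apply: le_trans epsle _.
  have : kappa / 2 * q = eps0 by rewrite /q; field; rewrite gt_eqF.
  move=> {1}<-; rewrite ler_wpM2l //; [by rewrite divr_ge0 // ltW|rewrite DE; lra].
apply: (@le_trans _ _ (expR (- (eps ^+ 2 / (2 * D))))); last first.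
  have -> : eps ^+ 2 / (4 * D) = eps ^+ 2 / (2 * D) / 2 by field.
  apply: expRN_le_lin; first by rewrite divr_ge0 ?sqr_ge0 // mulr_ge0 // ltW.
  by rewrite ler_pdivrMr ?mulr_gt0 // mul1r; lra.
apply: (@le_trans _ _ (expR (- (eps / D * eps)) * expR ((eps / D) ^+ 2 * C))).
  by rewrite ler_wpM2l ?expR_ge0 // expR_ge1Dx.
rewrite -expRD ler_expR.
have -> : - (eps / D * eps) + (eps / D) ^+ 2 * C =
  - (eps ^+ 2 / (2 * D)) - (eps / D) ^+ 2 * (D / 2 - C) by field.
rewrite gerDl oppr_le0 mulr_ge0 ?sqr_ge0 // subr_ge0; rewrite DE; lra.
Qed.

(** * Tail bound for one aggregated U-statistic *)

Section MainBound.
Context (R : realType) (d : measure_display) (T : measurableType d)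
  (P : probability T R) (N p : nat) (Z : 'I_N -> T -> R * p.-tuple R).
Hypothesis mZ : forall i, measurable_fun setT (Z i).
Hypothesis indepZ : forall B : 'I_N -> set (R * p.-tuple R),
  (forall i, measurable (B i)) ->
  P (\bigcap_(i in [set: 'I_N]) (Z i @^-1` B i)) =
  (\prod_(i < N) P (Z i @^-1` B i))%E.
Variables (m n k : nat) (ker : k.-tuple (R * R) -> R) (j : 'I_p)
  (Sb : 'I_m -> {set 'I_N}).
Hypothesis mker : measurable_fun setT ker.

Let G (A : {set 'I_N}) := kern_at Z ker j (enum A).

(** This passes from the index sets of the U-statistic to the repetition-free tuples of the moment
    conditions. *)
Lemma uniq_enum_tuple_ex (A : {set 'I_N}) : #|A| = k ->
  exists2 t : k.-tuple 'I_N, uniq t & tval t = enum A.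
Proof.
by move=> cA; have sz : size (enum A) == k by [rewrite -cardE cA]; exists (Tuple sz) => //=;
  exact: enum_uniq.
Qed.

Lemma depends_on_kern_at (A : {set 'I_N}) : #|A| = k ->
  depends_on Z A (G A).
Proof.
move=> cA; have [t _ tA] := uniq_enum_tuple_ex cA.
rewrite /G -tA; apply: measurable_kern_at => // i.
rewrite memtE tA mem_enum; exact: measurable_cylinders.
Qed.

Hypothesis cS : forall l, #|Sb l| = n.

Lemma agg_UE w : agg_U Z n ker j Sb w =
  m%:R^-1 * \sum_(l < m) subset_mean k G (Sb l) w.
Proof. by congr (_ * _); apply: eq_bigr => l _; rewrite /subset_mean cS. Qed.

Lemma measurable_agg_U : measurable_fun setT (agg_U Z n ker j Sb).
Proof.
rewrite (funext agg_UE); apply: measurable_funM => //; apply: measurable_sum => l.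
apply: (depends_on_measurable mZ (A := Sb l)).
by apply: depends_on_subset_mean; exact: depends_on_kern_at.
Qed.

Variables (kappa K a th lam eps : R) (r : nat).

Lemma agg_U_tail :
  (0 < m)%N -> (k <= n)%N -> (r * k <= n)%N ->
  (forall l l', l != l' -> #|Sb l :&: Sb l'| = 0%N) ->
  (forall t : k.-tuple 'I_N, uniq t -> ('E_P[kern_at Z ker j t] = th%:E)%E) ->
  (forall t : k.-tuple 'I_N, uniq t ->
     ('E_P[fun w => expR (kappa * `|kern_at Z ker j t w|)] <= K%:E)%E) ->
  0 < kappa -> `|th| <= a -> 0 <= lam -> lam <= kappa / 2 ->
  (P [set w | (eps <= `|agg_U Z n ker j Sb w - th|)%R] <=
   (2 * (expR (- (lam * eps)) *
     (1 + lam ^+ 2 * (8 / kappa ^+ 2 * expR (kappa * a) * `|K|))) ^+ (m * r))%:E)%E.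
Proof.
move=> m0 kn rkn dS EG EKG k0 tha lam0 lamk.
set phi := 1 + _.
have phi0 : 0 <= phi.
  by rewrite addr_ge0 // mulr_ge0 ?sqr_ge0 // !mulr_ge0 ?expR_ge0 ?invr_ge0 ?sqr_ge0.
have dS' l l' : l != l' -> [disjoint Sb l & Sb l']%B.
  by move=> /dS /eqP; rewrite cards_eq0 finset.setI_eq0.
(* As [phi] is even in the parameter, one claim serves both tails. *)
have mgf sg : `|sg| = lam ->
    (\int[P]_x (expR (sg * (m * r)%:R * (agg_U Z n ker j Sb x - th)))%:E <=
     (phi ^+ (m * r))%:E)%E.
  move=> sgl; under eq_integral do rewrite agg_UE.
  apply: (mean_subset_mean_mgf mZ indepZ) => //.
  - exact: depends_on_kern_at.
  - move=> A cA; have [t ut tA] := uniq_enum_tuple_ex cA.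
    have -> : phi = 1 + sg ^+ 2 * (8 / kappa ^+ 2 * expR (kappa * a) * `|K|).
      by rewrite /phi -sgl real_normK // num_real.
    rewrite /G -tA; apply: mgf_bound => //.
    + apply: measurable_kern_at => // i _; exact: mZ.
    + by rewrite sgl.
    + exact: EG.
    + exact: EKG.
  - by move=> l; rewrite cS.
  - by move=> l; rewrite cS.
apply: chernoff_two_sided => //.
- exact: measurable_agg_U.
- by apply: mgf; rewrite ger0_norm.
- by apply: mgf; rewrite normrN ger0_norm.
Qed.

End MainBound.

(** * Choice of constants and union bound *)

Theorem theorem1 (R : realType) (s : nat) (g : gexpr R s) (kappa0 K a b c : R) :
  0 < kappa0 -> 0 < a -> 0 < b -> 0 < c ->
  exists eta : R, 0 < eta /\
  forall (tau : R) (kdeg : 'I_s -> nat)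
    (d : measure_display) (T : measurableType d) (P : probability T R)
    (N m n p : nat)
    (Z : 'I_N -> T -> R * p.-tuple R)
    (ker : 'I_p -> forall h : 'I_s, (kdeg h).-tuple (R * R) -> R)
    (theta : 'I_p -> 'I_s -> R)
    (Sb : 'I_m -> {set 'I_N}),
  0 < tau < 2^-1 ->
  (* N = m n, n a positive integer, k = max_h k_h <= n *)
  N = (m * n)%N -> (0 < m)%N -> (0 < n)%N ->
  (\max_(h < s) kdeg h <= n)%N ->
  (* S_1, ..., S_m partition {1..N}, each of size n *)
  (forall l, #|Sb l| = n) ->
  (forall l l', l != l' -> #|Sb l :&: Sb l'| = 0%N) ->
  (forall i : 'I_N, exists l, i \in Sb l) ->
  (* (Y_i, X_i), i = 1..N, are i.i.d. *)
  (forall i, measurable_fun setT (Z i)) ->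
  (forall B : 'I_N -> set (R * p.-tuple R), (forall i, measurable (B i)) ->
     P (\bigcap_(i in [set: 'I_N]) (Z i @^-1` B i)) =
     (\prod_(i < N) P (Z i @^-1` B i))%E) ->
  (forall (i i' : 'I_N) (B : set (R * p.-tuple R)), measurable B ->
     P (Z i @^-1` B) = P (Z i' @^-1` B)) ->
  (* symmetric measurable kernels, unbiased for theta *)
  (forall j h, measurable_fun setT (ker j h)) ->
  (forall j h (t t' : (kdeg h).-tuple (R * R)), perm_eq t t' -> ker j h t = ker j h t') ->
  (forall j h (t : (kdeg h).-tuple 'I_N), uniq t ->
     ('E_P[kern_at Z (ker j h) j t] = (theta j h)%:E)%E) ->
  (* Condition (C1) *)
  (forall j h (t : (kdeg h).-tuple 'I_N), uniq t ->
     ('E_P[fun w => expR (kappa0 * `|kern_at Z (ker j h) j t w|)] <= K%:E)%E) ->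
  (* Condition (C2) *)
  (forall j h, `|theta j h| <= a) ->
  (forall j, gnondeg b g (theta j)) ->
  (P [set w | exists j : 'I_p,
       match geval g (fun h => agg_U Z n (ker j h) j Sb w), geval g (theta j) with
       | Some u, Some o => (c * (N%:R `^ (- tau)) <= `|u - o|)%R
       | _, _ => True
       end]
   <= (eta * p%:R * (1 - (N%:R `^ (- (2 * tau))) / eta)
        ^+ (m * (n %/ \max_(h < s) kdeg h)))%:E)%E.
Proof.
move=> k0 a0 b0 c0.
have [M [L [d0 [M0 L0 d00 stab]]]] := geval_stable g a0 b0.
(* Deviations up to [C1 * N^(-tau)] stay within the stability radius [d0] and move [g] by less than
   [c * N^(-tau)]. *)
pose C1 := Num.min (c / (2 * L)) d0.
have C10 : 0 < C1 by rewrite lt_min d00 andbT divr_gt0 ?mulr_gt0.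
have C1d : C1 <= d0 by rewrite ge_min lexx orbT.
have C1c : L * C1 < c.
  have : C1 <= c / (2 * L) by rewrite ge_min lexx.
  rewrite ler_pdivlMr ?mulr_gt0 // => h.
  by have := mulr_gt0 L0 C10; lra.
pose C := 8 / kappa0 ^+ 2 * expR (kappa0 * a) * `|K|.
have C0 : 0 <= C by rewrite !mulr_ge0 ?expR_ge0 ?invr_ge0 ?sqr_ge0.
have [D D0 rate] := chernoff_rate k0 C0 C10.
pose eta0 := 4 * D / C1 ^+ 2.
have eta00 : 0 < eta0 by rewrite divr_gt0 ?mulr_gt0 ?exprn_gt0.
(* [2 * s] pays for two tails and [s] components in the union bound; [eta0] is the constant for
   which [eps^2 / (4 D)] equals [N^(-2 tau) / eta0]. *)
exists (1 + 2 * s%:R + eta0).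
set eta := (1 + 2 * s%:R + eta0).
have s0 : 0 <= s%:R :> R by [].
have eta1 : 0 < eta by rewrite /eta; lra.
split=> // tau kdeg d T P N m n p Z ker theta Sb /andP[tau0 _] NE m0 n0 kn cS dS _ mZ
  indepZ _ mker _ EG EKG tha nd.
set kmax := \max_(h < s) kdeg h in kn *; set r := (n %/ kmax)%N.
have kh h : (kdeg h <= kmax)%N by rewrite /kmax (bigD1 h) //= leq_maxl.
pose x := N%:R `^ (- tau) : R.
have N1 : 1 <= N%:R :> R by rewrite ler1n NE muln_gt0 m0.
have x0 : 0 < x by apply: powR_gt0; apply: lt_le_trans N1.
have x1 : x <= 1.
  by rewrite -(powRr0 N%:R); apply: ler_powR => //; rewrite oppr_le0 ltW.
have x2 : N%:R `^ (- (2 * tau)) = x ^+ 2.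
  by rewrite /x -powR_mulrn ?powR_ge0 // -powRrM; congr (_ `^ _); ring.
rewrite x2.
pose eps := C1 * x.
have eps0 : 0 < eps by rewrite mulr_gt0.
have epsC : eps <= C1 by rewrite ger_pMr.
have [lamk rate_eps] := rate eps eps0 epsC.
pose Q := 1 - x ^+ 2 / eta.
have xeta : 1 - eps ^+ 2 / (4 * D) <= Q.
  have -> : eps ^+ 2 / (4 * D) = x ^+ 2 / eta0.
    by rewrite /eps /eta0; field; rewrite !gt_eqF.
  rewrite lerD2l lerN2 ler_wpM2l ?sqr_ge0 // lef_pV2 ?posrE //.
  by rewrite /eta; lra.
(* The base [Q] is nonnegative since it dominates a nonnegative Chernoff factor; this allows powers
   to be compared. *)
have Q0' : 0 <= expR (- (eps / D * eps)) * (1 + (eps / D) ^+ 2 * C).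
  by rewrite mulr_ge0 ?expR_ge0 // addr_ge0 // mulr_ge0 ?sqr_ge0.
have Q0 : 0 <= Q by apply: le_trans Q0' (le_trans rate_eps xeta).
pose Ev j h := [set w | eps <= `|agg_U Z n (ker j h) j Sb w - theta j h|].
have mU j h : measurable_fun setT (agg_U Z n (ker j h) j Sb).
  exact: measurable_agg_U.
have mEv j h : measurable (Ev j h).
  apply: measurable_ge_set; apply: measurableT_comp => //.
  exact: measurable_funB.
have PEv j h : (P (Ev j h) <= (2 * Q ^+ (m * r))%:E)%E.
  (* The same [r] serves all components: [r] blocks of the largest degree fit into [n] indices,
     hence so do smaller ones. *)
  have rk : (r * kdeg h <= n)%N.
    by apply: leq_trans (leq_trunc_div n kmax); rewrite leq_mul2l kh orbT.
  have lam0 : 0 <= eps / D by rewrite divr_ge0 // ltW.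
  apply: le_trans (agg_U_tail mZ indepZ (mker j h) cS _
    m0 (leq_trans (kh h) kn) rk dS (EG j h) (EKG j h) k0 (tha j h) lam0 lamk) _.
  rewrite lee_fin ler_pM2l //; apply: lerXn2r; rewrite ?nnegrE //.
  exact: le_trans rate_eps xeta.
set EV := [set w | exists j : 'I_p, _].
(* By contraposition: if every component is within [eps], stability makes both evaluations defined
   and less than [c * x] apart, so the undefined case is excluded as well. *)
have sub : EV `<=` \big[setU/set0]_(j < p) \big[setU/set0]_(h < s) Ev j h.
  move=> w [j hj]; rewrite -bigcup_seq; exists j; first by rewrite /= mem_index_enum.
  rewrite -bigcup_seq; apply: contrapT => nex.
  have close h : `|agg_U Z n (ker j h) j Sb w - theta j h| <= eps.
    rewrite leNgt; apply/negP => lt; apply: nex; exists h => /=.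
      by rewrite mem_index_enum.
    exact: ltW.
  have [|o [u [eo eu _ uo]]] := stab (theta j) (fun h => agg_U Z n (ker j h) j Sb w) eps
    (tha j) (nd j) (ltW eps0) _ close.
    exact: le_trans epsC C1d.
  move: hj; rewrite eo eu => hj; have := le_trans hj uo.
  rewrite -/x /eps mulrA ler_pM2r //; lra.
have mEV : measurable EV.
  have -> : EV = \bigcup_(j in [set: 'I_p]) [set w |
     match geval g (fun h => agg_U Z n (ker j h) j Sb w), geval g (theta j) with
       | Some u, Some o => (c * x <= `|u - o|)%R
       | _, _ => True
       end].
    by apply/seteqP; split=> [w [j hj]|w [j _ hj]]; exists j.
  apply: fin_bigcup_measurable => // j _.
  case: (geval g (theta j)) => [ o|]; last first.
    rewrite (_ : [set w | _] = setT) //; apply/seteqP; split=> // w _ /=.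
    by case: geval.
  have [ms mv] := measurable_geval g (v := fun w h => agg_U Z n (ker j h) j Sb w) (mU j).
  (* The deviation event, undefinedness included, as a measurable boolean function. *)
  pose dev w := ~~ isSome (geval g (fun h => agg_U Z n (ker j h) j Sb w)) || (c * x <=
     `|odflt 0 (geval g (fun h => agg_U Z n (ker j h) j Sb w)) - o|).
  have mdev : measurable_fun setT dev.
    apply: measurable_or; first exact: measurable_neg.
    apply: measurable_fun_ler => //.
    by apply: measurableT_comp => //; apply: measurable_funB.
  rewrite (_ : [set w | _] = [set w | dev w]); last first.
    by apply/seteqP; split=> w /=; rewrite /dev; case: geval.
  by rewrite -[X in measurable X]setTI; exact: (mdev measurableT [set true]).
apply: (@le_trans _ _ (\sum_(j < p) \sum_(h < s) (2 * Q ^+ (m * r))%:E)%E).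
  apply: (@le_trans _ _ (P (\big[setU/set0]_(j < p) \big[setU/set0]_(h < s) Ev j h))).
    apply: le_measure => //; rewrite inE //.
    by do 2 (apply: bigsetU_measurable => ? _).
  apply: le_trans (measure_bigsetU_le P _ _) _ => [j|].
    by apply: bigsetU_measurable => h _.
  apply: lee_sum => j _.
  apply: le_trans (measure_bigsetU_le P _ _) _ => //.
  by apply: lee_sum => h _.
under eq_bigr do rewrite sumEFin.
rewrite !sumEFin !sumr_const !card_ord lee_fin -/Q.
have -> : 2 * Q ^+ (m * r) *+ s *+ p = 2 * s%:R * p%:R * Q ^+ (m * r).
  by rewrite -[LHS]mulr_natr -[X in X * _]mulr_natr; ring.
rewrite ler_wpM2r ?exprn_ge0 // ler_wpM2r //.
by rewrite /eta; lra.
Qed.
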